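(* Let $T>0$ and let $L$ be the Lagrangian defined in the context (extended to all $t\in\mathbb{R}$ as described there). Then $L$ does not satisfy the following condition: for every $r>0$ there exists $k>0$ such that for every $(t,x,v)\in\mathbb{R}\times[-r,r]\times\mathbb{R}$ and every $(w_1,w_2,p)\in\partial L(t,x,v)$ one has $$|(w_1,w_2)|\le k\,(1+|v|+|L(t,x,v)|)(1+|p|).$$
   Context: Define $\varphi:[0,T]\times\mathbb{R}\to\mathbb{R}$ by $\varphi(t,x)=\sqrt{|t-x|}\,\exp\!\big(2\sqrt{|t-x|}\big)$. The Lagrangian $L:[0,T]\times\mathbb{R}\times\mathbb{R}\to\mathbb{R}\cup\{+\infty\}$ is $$L(t,x,v)=\begin{cases}+\infty & \text{if } |v|>2,\ t\neq x,\\ \frac{|v|}{2\varphi(t,x)} & \text{if } |v|\le 2,\ t\ne x,\\ 0 & \text{if } v=0,\ t=x,\\ +\infty & \text{if } v\neq 0,\ t=x.\end{cases}$$ It is extended to $t\in\mathbb{R}$ by $L(t,x,v):=L(0,x,v)$ for $t<0$ and $L(t,x,v):=L(T,x,v)$ for $t>T$. For $f:\mathbb{R}^m\to\mathbb{R}\cup\{+\infty\}$ and a point $z$ with $f(z)<+\infty$, the (regular) subdifferential $\partial f(z)$ is the set of $v\in\mathbb{R}^m$ such that $\liminf_{y\to z}\frac{f(y)-f(z)-\langle v,y-z\rangle}{|y-z|}\ge 0$; at points where $f=+\infty$ there are no subgradients. $|\cdot|$ is the Euclidean norm. *)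

(* Defs.v *)
From HB Require Import structures.
From mathcomp Require Import all_boot all_order all_algebra.
From mathcomp Require Import all_classical all_reals all_analysis.
Set Implicit Arguments.
Unset Strict Implicit.
Unset Printing Implicit Defensive.
Import Order.TTheory GRing.Theory Num.Theory.
Import numFieldNormedType.Exports.
Local Open Scope ring_scope.

Definition dotprod (R : realType) (m : nat) (u v : 'rV[R]_m) : R :=
  \sum_(i < m) u 0 i * v 0 i.

(* The library norm `|u| on 'rV[R]_m is the sup norm, hence this definition.
   Both norms induce the same topology, so the library filters y --> z can be
   used with either of them. *)
Definition enorm (R : realType) (m : nat) (u : 'rV[R]_m) : R :=
  Num.sqrt (\sum_(i < m) u 0 i ^+ 2).

Definition vec2 (R : realType) (a b : R) : 'rV[R]_2 :=
  \row_(i < 2) [:: a; b]`_i.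

Definition vec3 (R : realType) (a b c : R) : 'rV[R]_3 :=
  \row_(i < 3) [:: a; b; c]`_i.

(* f stands for a function with values in R U {+oo}: it should not take the
   value -oo. The limit inferior is over the punctured neighborhoods of z. *)
Definition subdifferential (R : realType) (m : nat) (f : 'rV[R]_m -> \bar R)
    (z : 'rV[R]_m) : set 'rV[R]_m :=
  [set v | (f z < +oo)%E /\
    (0 <= limf_einf
       (fun y : 'rV[R]_m =>
          (f y - f z - (dotprod v (y - z))%:E) * ((enorm (y - z))^-1)%:E)
       (z^')%classic)%E].

Definition phi (R : realType) (t x : R) : R :=
  Num.sqrt `|t - x| * expR (2 * Num.sqrt `|t - x|).

(* The formula does not involve T; it is meant for t in [0, T]. *)
Definition lagrangian0 (R : realType) (t x v : R) : \bar R :=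
  if t != x then
    if 2 < `|v| then +oo%E else (`|v| / (2 * phi t x))%:E
  else
    if v == 0 then 0%E else +oo%E.

Definition lagrangian (R : realType) (T t x v : R) : \bar R :=
  if t < 0 then lagrangian0 0 x v
  else if T < t then lagrangian0 T x v
  else lagrangian0 t x v.

Definition lagrangian_vec (R : realType) (T : R) (z : 'rV[R]_3) : \bar R :=
  lagrangian T (z 0 0) (z 0 1) (z 0 2).

(* Main.v *)
Require Import Defs.
From HB Require Import structures.
From mathcomp Require Import all_boot all_order all_algebra.
From mathcomp Require Import all_classical all_reals all_analysis.
From mathcomp Require Import ring lra.
Import Order.TTheory GRing.Theory Num.Theory.
Import numFieldNormedType.Exports.
Local Open Scope ring_scope.

(** Off the diagonal t = x the Lagrangian is the speed |v| times a singular
    weight of the gap s = |t - x|, of order s^(-1/2) as s tends to 0. For a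
    bounded speed such as v = 1, the value L and the slope p in v are
    therefore both of order s^(-1/2), so the right-hand side of the growth
    condition is at most of order 1/s. The slope in (t, x) is the derivative
    of the weight, of order s^(-3/2), and so no constant k can work for small
    gaps.

    The points used are (t, x, v) = (a^2, 0, 1) with a small, which makes the
    square root of the gap equal to a. The weight g lies above a line of slope
    m through its value at a^2 ([unit_cost_tangent]), and
      v g(s) - g(a^2) - m (s - a^2) - g(a^2) (v - 1)
        = (g(s) - g(a^2) - m (s - a^2)) + (v - 1) (g(s) - g(a^2)).
    The first term is nonnegative and the second is o(|y - z|) by continuity
    of g, so (m, -m, g(a^2)) is a subgradient ([lagrangian_subgradient]). *)

Lemma ler_coord_enorm (R : realType) (m : nat) (u : 'rV[R]_m) (i : 'I_m) :
  `|u 0 i| <= enorm u.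
Proof.
rewrite /enorm -sqrtr_sqr; apply: ler_wsqrtr.
rewrite (bigD1 i) //= lerDl; apply: sumr_ge0 => j _; exact: sqr_ge0.
Qed.

Lemma enorm_ge0 (R : realType) (m : nat) (u : 'rV[R]_m) : 0 <= enorm u.
Proof. exact: sqrtr_ge0. Qed.

(** Working with the affine lower bound up to [e * enorm (y - z)] avoids both
    the quotient and the extended reals of the definition. The real function
    [g] stands for [f] where [f] is finite. *)
Lemma subdifferential_near (R : realType) (m : nat) (f : 'rV[R]_m -> \bar R)
    (g : 'rV[R]_m -> R) (z v : 'rV[R]_m) :
  (\forall y \near z, f y = (g y)%:E) ->
  (forall e : R, 0 < e -> \forall y \near z,
     g z + dotprod v (y - z) - e * enorm (y - z) <= g y) ->
  subdifferential f z v.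
Proof.
move=> fg lbg; have fz : f z = (g z)%:E := nbhs_singleton fg.
split; first by rewrite fz ltry.
apply/lee_addgt0Pr => e e0; rewrite -leeBlDr // sub0e -EFinN.
set q := fun y => _.
set A := [set y | ((- e)%:E <= q y)%E]%classic.
apply: (@le_trans _ _ (ereal_inf [set q y | y in A])).
  by apply: le_ereal_inf_tmp => _ /= [y ? <-].
rewrite limf_einfE; apply: ereal_sup_ubound; exists A => //.
apply: nbhs_dnbhs; near=> y; rewrite /A /=.
rewrite /q fz (near fg y) // -!EFinB -EFinM lee_fin.
have := enorm_ge0 _ _ (y - z); rewrite le_eqVlt => /predU1P[<-|n0].
  (* The inverse of 0 being 0, the quotient vanishes when [enorm (y - z)] does,
     so the bound holds there too. *)
  by rewrite invr0 mulr0 oppr_le0 ltW.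
rewrite ler_pdivlMr //.
have : g z + dotprod v (y - z) - e * enorm (y - z) <= g y.
  by near: y; exact: lbg.
lra.
Unshelve. all: by end_near. Qed.

(** The price of speed 1 at distance [s] from the diagonal, that is
    1 / (2 phi(t, x)) with s = |t - x|. *)
Definition unit_cost (R : realType) (s : R) : R :=
  (2 * (Num.sqrt s * expR (2 * Num.sqrt s)))^-1.
Arguments unit_cost {R}.

Lemma continuous_unit_cost (R : realType) (s : R) : 0 < s ->
  {for s, continuous unit_cost}.
Proof.
move=> s0; apply: cvgV.
  by rewrite gt_eqF // !mulr_gt0 ?expR_gt0 ?sqrtr_gt0.
apply: cvgM; first exact: cvg_cst.
apply: cvgM; first exact: sqrt_continuous.
apply: continuous_comp; last exact: continuous_expR.
by apply: cvgM; [exact: cvg_cst|exact: sqrt_continuous].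
Qed.

(** The logarithm of the weight is, up to a constant, - 2 sqrt s - (ln s) / 2,
    which is convex, so the weight itself is convex; the bound is its tangent
    line at [a ^+ 2]. The proof divides by the weight at [a ^+ 2] and, with
    b = sqrt s, reduces to 1 - X <= (a / b) exp (2 a - 2 b) where
    X = (b^2 - a^2) (1 / a + 1 / (2 a^2)), which follows from two uses of
    1 + y <= exp y. *)
Lemma unit_cost_tangent (R : realType) (a s : R) : 0 < a -> 0 < s ->
  unit_cost (a ^+ 2) * (1 - (s - a ^+ 2) * (a^-1 + (2 * a ^+ 2)^-1))
    <= unit_cost s.
Proof.
move=> a0 s0; have : 0 < Num.sqrt s by rewrite sqrtr_gt0.
rewrite -{2}(sqr_sqrtr (ltW s0)) /unit_cost sqrtr_sqr (gtr0_norm a0).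
move: (Num.sqrt s) => b b0.
set X := (_ - _) * _.
have -> : (2 * (b * expR (2 * b)))^-1 =
    (2 * (a * expR (2 * a)))^-1 * (a / b * expR (2 * a - 2 * b)).
  rewrite expRD expRN; field.
  by rewrite !gt_eqF ?expR_gt0.
apply: ler_wpM2l; first by rewrite invr_ge0 ltW // !mulr_gt0 ?expR_gt0.
apply: (le_trans (expR_ge1Dx (- X))).
(* The inequality ln y <= y - 1 at y = b / a, exponentiated. *)
have ratio : expR (1 - b / a) <= a / b.
  rewrite -(invrK (a / b)) invf_div.
  rewrite -(opprB (b / a)) expRN lef_pV2 ?posrE ?expR_gt0 ?divr_gt0 //.
  by apply: le_trans (expR_ge1Dx _); rewrite addrCA subrr addr0.
apply: le_trans (ler_wpM2r (expR_ge0 _) ratio).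
rewrite -expRD ler_expR -subr_ge0.
have -> : 1 - b / a + (2 * a - 2 * b) - - X =
   (b - a) ^+ 2 * (a^-1 + (2 * a ^+ 2)^-1).
  by rewrite /X; field; rewrite gt_eqF.
by rewrite mulr_ge0 ?sqr_ge0 // addr_ge0 // invr_ge0 ltW // mulr_gt0 ?exprn_gt0.
Qed.

Lemma lagrangian_unit_cost (R : realType) (T t x v : R) :
  0 <= t <= T -> x < t -> 0 <= v <= 2 ->
  lagrangian T t x v = (v * unit_cost (t - x))%:E.
Proof.
move=> /andP[t0 tT] xt /andP[v0 v2].
rewrite /lagrangian ltNge t0 /= ltNge tT /= /lagrangian0 gt_eqF //=.
by rewrite (ger0_norm v0) ltNge v2 /= /phi /unit_cost gtr0_norm ?subr_gt0.
Qed.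

Lemma vec3E (R : realType) (a b c : R) :
  (vec3 a b c 0 0 = a) * (vec3 a b c 0 1 = b) * (vec3 a b c 0 2 = c).
Proof. by rewrite /vec3 !mxE. Qed.

(** Strictly inside 0 < t < T, x < t and 0 < v < 2 the Lagrangian is the smooth
    product of v and the weight of t - x, hence [m] is the slope in t, its
    opposite the slope in x, and [g] the slope in v. *)
Lemma lagrangian_subgradient (R : realType) (T a : R) :
  0 < a -> a ^+ 2 < T ->
  let g := unit_cost (a ^+ 2) in
  let m := - g * (a^-1 + (2 * a ^+ 2)^-1) in
  subdifferential (lagrangian_vec T) (vec3 (a ^+ 2) 0 1) (vec3 m (- m) g).
Proof.
move=> a0 aT g m; set z := vec3 (a ^+ 2) 0 1.
have a20 : 0 < a ^+ 2 by rewrite exprn_gt0.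
have coord (i : 'I_3) : ((fun y : 'rV[R]_3 => y 0 i) @ z --> z 0 i)%classic.
  exact: coord_continuous.
have gap : ((fun y : 'rV[R]_3 => y 0 0 - y 0 1) @ z --> a ^+ 2)%classic.
  have -> : a ^+ 2 = z 0 0 - z 0 1 by rewrite !vec3E subr0.
  exact: (cvgB (coord 0) (coord 1)).
have gap_gt0 : \forall y \near z, 0 < (y : 'rV[R]_3) 0 0 - y 0 1.
  exact: (cvgr_gt _ gap).
have unit_cost_near :
    ((fun y : 'rV[R]_3 => unit_cost (y 0 0 - y 0 1)) @ z --> g)%classic.
  by apply: continuous_cvg gap; exact: continuous_unit_cost.
apply: (@subdifferential_near _ _ _
  (fun y => y 0 2 * unit_cost (y 0 0 - y 0 1))).
- near=> y; rewrite /lagrangian_vec lagrangian_unit_cost //.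
  + apply/andP; split; apply: ltW; near: y.
      by apply: (cvgr_gt _ (coord 0)); rewrite vec3E.
    by apply: (cvgr_lt _ (coord 0)); rewrite vec3E.
  + by rewrite -subr_gt0; near: y.
  + apply/andP; split; apply: ltW; near: y.
      by apply: (cvgr_gt _ (coord 2)); rewrite vec3E.
    by apply: (cvgr_lt _ (coord 2)); rewrite vec3E ltr1n.
- move=> e e0; near=> y.
  have tgt : g + m * (y 0 0 - y 0 1 - a ^+ 2) <= unit_cost (y 0 0 - y 0 1).
    have y0 : 0 < y 0 0 - y 0 1 by near: y.
    apply: le_trans (unit_cost_tangent _ _ _ a0 y0).
    by rewrite /m -/g; lra.
  have osc : `|g - unit_cost (y 0 0 - y 0 1)| <= e.
    by near: y; move/cvgrPdist_le: unit_cost_near; exact.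
  (* The product of the two increments is negligible: one is at most
     the distance to [z], the other tends to 0. *)
  have cross : `|(y 0 2 - 1) * (g - unit_cost (y 0 0 - y 0 1))|
      <= e * enorm (y - z).
    rewrite normrM mulrC ler_pM //.
    have := ler_coord_enorm _ _ (y - z) 2.
    by rewrite !mxE /=.
  have -> : dotprod (vec3 m (- m) g) (y - z) =
      m * (y 0 0 - y 0 1 - a ^+ 2) + g * (y 0 2 - 1).
    rewrite /dotprod !big_ord_recl big_ord0.
    rewrite (_ : lift ord0 ord0 = 1); last exact/val_inj.
    rewrite (_ : lift ord0 (lift ord0 ord0) = 2); last exact/val_inj.
    rewrite ![(y - z) _ _]mxE ![(- z) _ _]mxE !vec3E; ring.
  rewrite !vec3E subr0 mul1r -/g.
  have := ler_norm ((y 0 2 - 1) * (g - unit_cost (y 0 0 - y 0 1))).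
  lra.
Unshelve. all: by end_near. Qed.

Theorem proposition3p2 (R : realType) (T : R) (hT : 0 < T) :
  ~ (forall r : R, 0 < r ->
     exists2 k : R, 0 < k &
       forall t x v : R, - r <= x <= r ->
       forall w1 w2 p : R,
         subdifferential (lagrangian_vec T) (vec3 t x v) (vec3 w1 w2 p) ->
         ((enorm (vec2 w1 w2))%:E <=
           k%:E * (1 + `|v|%:E + `|lagrangian T t x v|) * (1 + `|p|)%:E)%E).
Proof.
move=> /(_ 1 ltr01)[k k0 growth].
have k12 : 0 < 12 * k by rewrite mulr_gt0.
(* The bound 1 / 8 makes the weight [g] at least 1, so that the factors
   2 + g and 1 + g are at most 3 g and 2 g; then the growth condition gives
   g / (2 a^2) <= 6 k g^2, while 2 a g <= 1 turns this into 6 k a >= 1, against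
   12 k a <= 1. The bound T keeps t = a^2 inside ]0, T[. *)
have [a [a0 a8 ak aT]] : exists a : R,
    [/\ 0 < a, a <= 8^-1, 12 * k * a <= 1 & a <= T].
  exists (Num.min 8^-1 (Num.min (12 * k)^-1 T)); split.
  - by rewrite !lt_min !invr_gt0 hT k12 ltr0n.
  - by rewrite ge_min lexx.
  - by rewrite -ler_pdivlMl // mulr1 !ge_min lexx /= orbT.
  - by rewrite !ge_min lexx !orbT.
have a20 : 0 < a ^+ 2 by rewrite exprn_gt0.
have a2T : a ^+ 2 < T by nra.
have x01 : - 1 <= (0 : R) <= 1 by lra.
have := growth _ _ _ x01 _ _ _ (lagrangian_subgradient _ _ _ a0 a2T).
rewrite lagrangian_unit_cost ?(ltW a20) ?(ltW a2T) ?ler01 ?ler1n //.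
set g := unit_cost (a ^+ 2); set m := - g * _.
rewrite subr0 mul1r normr1.
have gE : 2 * a * g = expR (- (2 * a)).
  rewrite /g /unit_cost sqrtr_sqr gtr0_norm // expRN; field.
  by rewrite !gt_eqF ?expR_gt0.
have g1 : 1 <= g.
  have := expR_ge1Dx (- (2 * a)); rewrite -gE => lb; rewrite leNgt.
  apply/negP => glt1; have : a * g < a by rewrite gtr_pMr.
  lra.
have ga : 2 * a * g <= 1.
  by rewrite gE -[leRHS]expR0 ler_expR; lra.
rewrite /= -!EFinD -!EFinM lee_fin (@ger0_norm _ g); last lra.
apply/negP; rewrite -ltNge.
have low : g / (2 * a ^+ 2) <= enorm (vec2 m (- m)).
  apply: le_trans (ler_coord_enorm _ _ _ 0); rewrite mxE /= /m mulNr normrN.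
  apply: le_trans (ler_norm _); apply: ler_wpM2l; first lra.
  by rewrite lerDr invr_ge0 ltW.
apply: lt_le_trans low.
rewrite ltr_pdivlMr ?mulr_gt0 //.
have up : (1 + 1 + g) * (1 + g) <= 6 * g ^+ 2 by nra.
have : k * (1 + 1 + g) * (1 + g) * (2 * a ^+ 2) <= g * 2^-1.
  have ka : 0 <= k * (2 * a ^+ 2) by rewrite !mulr_ge0 ?ltW.
  have h1 := ler_wpM2l ka up.
  have h2 : (12 * k * a) * (a * g) <= 1 * 2^-1 by apply: ler_pM; nra.
  have g0 : 0 <= g by lra.
  have h3 := ler_wpM2r g0 h2.
  lra.
lra.
Qed.
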